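(* Let $F_{1111}(n)$ be the number of zero-one matrices (of any size) with exactly $n$ ones and no zero row or zero column, and let $F_{1011}(n)$ be the number of those matrices which in addition have no two equal rows. Then $F_{1011}(n)=o(F_{1111}(n))$ as $n\to\infty$.
   Context: Matrices are counted as arrays: the order of rows and columns matters (no identification under row or column permutations). In $F_{1111}(n)$, repeated rows and columns are allowed; in $F_{1011}(n)$, repeated columns are allowed but repeated rows are forbidden. *)

(* Defs.v *)
From mathcomp Require Export all_boot all_order all_algebra.
From mathcomp Require Export finmap.
From mathcomp Require Export all_classical all_reals topology normedtype landau.

Set Implicit Arguments.
Unset Strict Implicit.
Unset Printing Implicit Defensive.

Import Order.TTheory GRing.Theory Num.Theory.
Import numFieldNormedType.Exports.

Local Open Scope classical_set_scope.

Definition ones k l (A : 'M[bool]_(k, l)) : nat :=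
  #|[set p : 'I_k * 'I_l | A p.1 p.2]%SET|.

Definition no_zero_row k l (A : 'M[bool]_(k, l)) : Prop :=
  forall i : 'I_k, row i A <> const_mx false.

Definition no_zero_col k l (A : 'M[bool]_(k, l)) : Prop :=
  forall j : 'I_l, col j A <> const_mx false.

Definition no_equal_rows k l (A : 'M[bool]_(k, l)) : Prop :=
  forall i1 i2 : 'I_k, i1 <> i2 -> row i1 A <> row i2 A.

Definition zo_matrix : Type := {d : nat * nat & 'M[bool]_(d.1, d.2)}.

Definition set1111 (n : nat) : set zo_matrix :=
  [set A | [/\ ones (tagged A) = n, no_zero_row (tagged A)
             & no_zero_col (tagged A)]].

Definition set1011 (n : nat) : set zo_matrix :=
  set1111 n `&` [set A | no_equal_rows (tagged A)].

(* [fset_set] returns the empty set on infinite sets; [finite_set1111] and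
   [finite_set1011] below show that this never happens here. *)
Definition F1111 (n : nat) : nat := (#|` fset_set (set1111 n) |)%fset.

Definition F1011 (n : nat) : nat := (#|` fset_set (set1011 n) |)%fset.

Lemma rows_le_ones k l (A : 'M[bool]_(k, l)) :
  no_zero_row A -> (k <= ones A)%N.
Proof.
move=> nz.
have ex i : exists j, A i j.
  apply: contrapT => /forallNP h; apply: (nz i).
  by apply/rowP => j; rewrite !mxE; apply/negbTE/negP/h.
have [f Af] := choice ex.
rewrite -[X in (X <= _)%N]card_ord /ones.
rewrite -(@card_imset _ _ (fun i => (i, f i))); last by move=> i j [].
by apply/subset_leq_card/fintype.subsetP => _ /imsetP[i _ ->]; rewrite inE.
Qed.

Lemma ones_tr k l (A : 'M[bool]_(k, l)) : ones A^T = ones A.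
Proof.
rewrite /ones -(@card_imset _ _ (fun p : 'I_l * 'I_k => (p.2, p.1))); last first.
  by move=> [a b] [c d] [-> ->].
apply: eq_card => -[i j]; apply/imsetP/idP => [[[a b]]|].
  by rewrite !inE /= mxE => ? [-> ->].
by rewrite inE /= => ?; exists (j, i); rewrite ?inE//= mxE.
Qed.

Lemma cols_le_ones k l (A : 'M[bool]_(k, l)) :
  no_zero_col A -> (l <= ones A)%N.
Proof.
move=> nz; rewrite -ones_tr; apply: rows_le_ones => i h; apply: (nz i).
by apply/colP => j; move/rowP: h => /(_ j); rewrite !mxE.
Qed.

Lemma finite_set1111 n : finite_set (set1111 n).
Proof.
apply: (@sub_finite_set _ _ (\bigcup_(d in `I_n.+1 `*` `I_n.+1)
   ((existT (fun d : nat * nat => 'M[bool]_(d.1, d.2)) d) @` setT))).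
  move=> [d A] [/= <- nr nc]; exists d; last by exists A.
  by split; rewrite /= ltnS; [exact: rows_le_ones|exact: cols_le_ones].
apply: bigcup_finite => [|d _]; first exact: finite_setX.
exact/finite_image/finite_finset.
Qed.

Lemma finite_set1011 n : finite_set (set1011 n).
Proof. exact/finite_setIl/finite_set1111. Qed.

(* Main.v *)
(* A matrix is identified with the set of positions of its ones.  Given a matrix
   with pairwise distinct rows and an ordered pair of its ones x <> y, split x and
   y off into rows of their own and then move y into the column of x.  This
   creates two equal rows, and the old matrix, x and y can be recovered from the
   new matrix, the location of the two equal rows, three bits and the old column
   of y.  As the old rows were distinct, the new matrix has only boundedly many
   (at most 40) ordered pairs of equal rows with a single one, so that
   n (n - 1) F1011(n) <= 40 * 8 * n * F1111(n). *)
Require Import Defs.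
From mathcomp Require Import zify.
Import Order.TTheory GRing.Theory Num.Theory.
Import numFieldNormedType.Exports.

Set Implicit Arguments.
Unset Strict Implicit.
Unset Printing Implicit Defensive.

Local Open Scope fset_scope.
Local Open Scope nat_scope.

(** * Zero-one matrices as finite point sets *)

Notation point := (nat * nat)%type.

(** For [h] a coordinate this expresses the absence of zero rows or columns without mentioning
    dimensions: the occupied indices form an initial segment. *)
Definition initial (h : point -> nat) (S : {fset point}) : Prop :=
  forall u a, u \in S -> a < h u -> exists2 v, v \in S & h v = a.

Definition incidence (n : nat) (S : {fset point}) : Prop :=
  [/\ #|` S| = n, initial fst S & initial snd S].

Definition alone (h : point -> nat) (S : {fset point}) (x : point) : bool :=
  all (fun u => (h u == h x) ==> (u == x)) S.

Lemma aloneP h S x :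
  reflect (forall u, u \in S -> h u = h x -> u = x) (alone h S x).
Proof.
apply: (iffP allP) => H u uS; first by move=> /eqP E; apply/eqP/(implyP (H u uS)).
by apply/implyP => /eqP E; apply/eqP/H.
Qed.

Lemma aloneNP h S x :
  reflect (exists u, [/\ u \in S, u <> x & h u = h x]) (~~ alone h S x).
Proof.
apply: (iffP allPn) => [[u uS]|[u [uS ux ux1]]].
  by rewrite negb_imply => /andP[/eqP E /eqP ne]; exists u.
by exists u => //; rewrite negb_imply ux1 eqxx /=; apply/eqP.
Qed.

Lemma imfset_can_in (f g : point -> point) (S : {fset point}) :
  {in S, cancel f g} -> [fset g u | u in [fset f v | v in S]] = S.
Proof.
move=> fK; apply/fsetP => u; apply/imfsetP/idP => /= [[w /imfsetP[v /= vS ->] ->]|uS].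
  by rewrite fK.
by exists (f u); rewrite ?fK// in_imfset.
Qed.

Lemma card_can_in_imfset (f g : point -> point) (S : {fset point}) :
  {in S, cancel f g} -> #|` [fset f u | u in S]| = #|` S|.
Proof. by move=> fK; rewrite card_in_imfset//; exact: can_in_inj fK. Qed.

(** The values 0, ..., [h u] are all attained on [S], and [n] points attain at most [n] values. *)
Lemma initial_lt n h S u : #|` S| = n -> initial h S -> u \in S -> h u < n.
Proof.
move=> <- hS uS; rewrite -(size_iota 0 (h u).+1) -(size_map h).
apply: uniq_leq_size; first exact: iota_uniq.
move=> a; rewrite mem_iota add0n ltnS /= leq_eqVlt => /orP[/eqP->|lt_a].
  exact: map_f.
by have [v vS <-] := hS _ _ uS lt_a; exact: map_f.
Qed.

(** * Splitting a one off into a row of its own *)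

(* [x] keeps its row index, while the rest of its row and all later rows are
   shifted down; [b] is [false] when [x] is alone in its row, and nothing moves. *)
Definition split_row (x : point) (b : bool) (u : point) : point :=
  if u == x then u else (u.1 + (b && (x.1 <= u.1)), u.2).

(** The comparison is strict: after a real split, row [x.1] holds only [x], and all displaced points
    have a larger row index. *)
Definition unsplit_row (x : point) (b : bool) (u : point) : point :=
  if u == x then u else (u.1 - (b && (x.1 < u.1)), u.2).

Lemma split_row_id x b : split_row x b x = x.
Proof. by rewrite /split_row eqxx. Qed.

Lemma split_row_snd x b u : (split_row x b u).2 = u.2.
Proof. by rewrite /split_row; case: ifP. Qed.

Lemma split_row_fst x b u : u <> x ->
  (split_row x b u).1 = u.1 + (b && (x.1 <= u.1)).
Proof. by rewrite /split_row => /eqP/negbTE ->. Qed.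

Lemma split_rowK x b : cancel (split_row x b) (unsplit_row x b).
Proof.
move=> u; rewrite /split_row; have [->|/eqP ux] := eqVneq u x.
  by rewrite /unsplit_row eqxx.
(* No other point lands on [x]: with [b] true row [x.1] is vacated, with [b] false nothing moves. *)
have ne : ((u.1 + (b && (x.1 <= u.1)), u.2) == x) = false.
  apply/eqP; case: u x ux => [u1 u2] [x1 x2] ux /= [E ?]; apply: ux.
  by congr (_, _) => //; case: b E => /=; lia.
by rewrite /unsplit_row ne; case: u {ux ne} => u1 u2; congr (_, _) => /=; case: b => /=; lia.
Qed.

Section SplitRow.
Variables (S : {fset point}) (x : point).
Hypothesis xS : x \in S.

Let b := ~~ alone fst S x.
Let S' := [fset split_row x b u | u in S].

(** Rows before [x.1] stay, [x] fills row [x.1], the rest of its row fills the next one, and later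
    rows shift; columns are untouched. *)
Lemma split_row_incidence n : incidence n S -> incidence n S'.
Proof.
move=> [cS iS1 iS2]; split.
- by rewrite (card_can_in_imfset (in1W (split_rowK x b))).
- move=> _ a /imfsetP[u /= uS ->] lt_a.
  have in' v : v \in S -> split_row x b v \in S' by move=> vS; rewrite in_imfset.
  case: (aloneP fst S x) @b @S' in' lt_a => al /= in' lt_a.
    have E v : split_row x false v = v.
      by rewrite /split_row /= addn0; case: ifP => //; case: v.
    rewrite E in lt_a; have [v vS va] := iS1 _ _ uS lt_a.
    by exists v => //; rewrite -(E v) in'.
  have /aloneNP[w [wS wx wx1]] : ~~ alone fst S x by apply/aloneP.
  have [lt_ax|] := ltnP a x.1.
    have [v vS va] := iS1 _ _ xS lt_ax; exists (split_row x true v); first exact: in'.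
    by rewrite split_row_fst /= ?va; [lia|move=> vx; move: va; rewrite vx; lia].
  rewrite leq_eqVlt => /orP[/eqP <-|lt_xa].
    by exists x => //; rewrite -{1}(split_row_id x true) in'.
  (* A second one [w] in the row of [x] keeps the new row occupied. *)
  have [->|ne_a] := eqVneq a x.1.+1.
    by exists (split_row x true w); rewrite ?in'// split_row_fst//= wx1; lia.
  have ux : u <> x by move=> ux; move: lt_a; rewrite ux split_row_id; lia.
  rewrite split_row_fst //= in lt_a.
  have [|v vS va] := iS1 _ a.-1 uS; first by move: lt_a; case: leqP => /=; lia.
  exists (split_row x true v); first exact: in'.
  by rewrite split_row_fst /= ?va; [lia|move=> vx; move: va; rewrite vx; lia].
- move=> _ a /imfsetP[u /= uS ->]; rewrite split_row_snd => lt_a.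
  have [v vS va] := iS2 _ _ uS lt_a.
  by exists (split_row x b v); rewrite ?in_imfset// split_row_snd.
Qed.

Lemma split_row_alone : alone fst S' x.
Proof.
apply/aloneP => _ /imfsetP[u /= uS ->].
have [->|/eqP ux] := eqVneq u x; first by rewrite split_row_id.
rewrite split_row_fst // /b; case: (aloneP fst S x) => al /=; last by case: leqP => /=; lia.
by rewrite addn0 => E; case: ux; exact: al.
Qed.

(** Keeps the first chosen one alone in its row while the second is split off. *)
Lemma split_row_alone_pres z :
  z \in S -> z <> x -> alone fst S z -> alone fst S' (split_row x b z).
Proof.
move=> zS zx /aloneP al; apply/aloneP => _ /imfsetP[u /= uS ->] E; congr split_row.
have [ux|/eqP ux] := eqVneq u x; last first.
  apply: al => //; move: E; rewrite !split_row_fst //; case: b => /=; lia.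
have xz : x.1 <> z.1 by move=> /al -/(_ xS) /esym.
move: E; rewrite ux split_row_id split_row_fst //.
by case: b => /=; [lia|rewrite addn0 => /xz].
Qed.

End SplitRow.

(** * Moving a one into another column *)

(* [c] is [true] when [y] is alone in its column, which is then deleted. *)
Definition move_col (x y : point) (c : bool) (u : point) : point :=
  let j := (if u == y then x else u).2 in (u.1, j - (c && (y.2 < j))).

(** [q] is the image of [y] and [v] its old column. A deleted column is reinserted before the
    current column [v], hence the non-strict comparison. *)
Definition unmove_col (q : point) (c : bool) (v : nat) (u : point) : point :=
  if u == q then (u.1, v) else (u.1, u.2 + (c && (v <= u.2))).

Lemma move_col_snd x y c u : u <> y ->
  (move_col x y c u).2 = u.2 - (c && (y.2 < u.2)).
Proof. by rewrite /move_col => /eqP/negbTE ->. Qed.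

Section MoveCol.
Variables (S : {fset point}) (x y : point).
Hypotheses (xS : x \in S) (yS : y \in S) (xy : x <> y).
Hypothesis (yal : alone fst S y).

Let c := alone snd S y.
Let S' := [fset move_col x y c u | u in S].

(** Rows are preserved and [y] is alone in its row, so no other point lands on the image of [y],
    which can thus be recognised. *)
Lemma move_colK :
  {in S, cancel (move_col x y c) (unmove_col (move_col x y c y) c y.2)}.
Proof.
move=> u uS; have [->|/eqP uy] := eqVneq u y.
  by rewrite /unmove_col eqxx /=; case: (y).
have ne : (move_col x y c u == move_col x y c y) = false.
  by apply/eqP => -[E _]; apply: uy; exact: (aloneP _ _ _ yal).
rewrite /unmove_col ne move_col_snd //=.
rewrite /c; case: (aloneP snd S y) => al /=; last by rewrite subn0 addn0; case: (u).
have uy2 : u.2 <> y.2 by move=> E; apply: uy; exact: al.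
by rewrite [RHS]surjective_pairing; congr (_, _); move: (u.2) (y.2) uy2 => a b ab; lia.
Qed.

Lemma move_col_same : (move_col x y c x).2 = (move_col x y c y).2.
Proof. by rewrite /move_col eqxx; move/eqP/negbTE: xy => ->. Qed.

Lemma move_col_alone z : alone fst S z -> alone fst S' (move_col x y c z).
Proof.
move=> /aloneP al; apply/aloneP => _ /imfsetP[u /= uS ->] /= E.
by congr move_col; exact: al.
Qed.

(** Only the column of [y] can become empty; this happens exactly when [y] is alone in it, and then
    it is deleted. *)
Lemma move_col_incidence n : incidence n S -> incidence n S'.
Proof.
move=> [cS iS1 iS2]; split.
- by rewrite (card_can_in_imfset move_colK).
- move=> _ a /imfsetP[u /= uS ->] /= lt_a.
  have [v vS va] := iS1 _ _ uS lt_a.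
  by exists (move_col x y c v); rewrite ?in_imfset.
- move=> _ a /imfsetP[u0 /= u0S ->].
  (* The image of [y] shares its column with the image of [x], so a point other than [y] can serve
     as reference. *)
  have [u [uS uy ->]] :
      exists u, [/\ u \in S, u <> y & (move_col x y c u0).2 = (move_col x y c u).2].
    have [->|/eqP u0y] := eqVneq u0 y; last by exists u0.
    by exists x; rewrite move_col_same.
  rewrite move_col_snd // => lt_a.
  have in' v : v \in S -> move_col x y c v \in S' by move=> vS; rewrite in_imfset.
  case: (aloneP snd S y) @c @S' in' lt_a => al /= in' lt_a.
    have uy2 : u.2 <> y.2 by move=> E; apply: uy; exact: al.
    have [lt_ay|le_ya] := ltnP a y.2.
      have [v vS va] := iS2 _ a yS lt_ay; exists (move_col x y true v); first exact: in'.
      by rewrite move_col_snd /=; [lia|move=> E; move: va; rewrite E; lia].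
    have [|v vS va] := iS2 _ a.+1 uS; first lia.
    exists (move_col x y true v); first exact: in'.
    by rewrite move_col_snd /=; [lia|move=> E; move: va; rewrite E; lia].
  rewrite subn0 in lt_a; have [v vS va] := iS2 _ _ uS lt_a.
  have [vy|/eqP vy] := eqVneq v y; last first.
    by exists (move_col x y false v); rewrite ?in'// move_col_snd //= subn0.
  (* If the witness is [y] itself, another one [w] of its column stays behind. *)
  have /aloneNP[w [wS wy wy2]] : ~~ alone snd S y by apply/aloneP.
  exists (move_col x y false w); rewrite ?in'// move_col_snd //= subn0.
  by rewrite wy2 -vy.
Qed.

End MoveCol.

(** * Equal rows with a single one *)

(* The rows in [W] are exempt: they are the ones altered by a surgery. *)
Definition twinless (W : seq nat) (S : {fset point}) : Prop :=
  forall u v, u \in S -> v \in S -> u.1 \notin W -> v.1 \notin W ->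
    alone fst S u -> alone fst S v -> u.2 = v.2 -> u = v.

(** Single-one rows come from single-one rows, except possibly row [x.1] and row [x.1 + b], which
    receives the rest of the row of [x]. Old exempt rows follow the shift. *)
Lemma split_row_twinless W S (x : point) (b : bool) : twinless W S ->
  twinless [:: x.1, x.1 + b & [seq a + (b && (x.1 <= a)) | a <- W]]
           [fset split_row x b u | u in S].
Proof.
move=> tS; set W' := _ :: _; set S' := [fset _ | _ in _].
have key u : u \in S -> (split_row x b u).1 \notin W' ->
    alone fst S' (split_row x b u) -> u.1 \notin W /\ alone fst S u.
  rewrite !inE => uS; have [->|/eqP ux] := eqVneq u x.
    by rewrite split_row_id eqxx.
  rewrite split_row_fst // !negb_or => /and3P[_ n2 n3] /aloneP al.
  have ux1 : u.1 <> x.1 by move=> E; move: n2; rewrite E leqnn andbT eqxx.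
  split; first by apply: contra n3 => uW; apply/mapP; exists u.1.
  apply/aloneP => w wS wu; apply: (can_inj (split_rowK x b)); apply: al.
    by rewrite in_imfset.
  have wx : w <> x by move=> E; apply: ux1; rewrite -wu E.
  by rewrite !split_row_fst ?wu.
move=> _ _ /imfsetP[u /= uS ->] /imfsetP[v /= vS ->] uW vW ua va.
have [uW0 ua0] := key _ uS uW ua; have [vW0 va0] := key _ vS vW va.
by rewrite !split_row_snd => /(tS _ _ uS vS uW0 vW0 ua0 va0) ->.
Qed.

(** The row of [y] is exempt, and for the other points deleting a column keeps distinct columns
    distinct. *)
Lemma move_col_twinless W S x y : x \in S -> y \in S -> x <> y ->
  alone fst S y -> y.1 \in W -> twinless W S ->
  twinless W [fset move_col x y (alone snd S y) u | u in S].
Proof.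
move=> xS yS xy yal yW tS; set c := alone snd S y; set S' := [fset _ | _ in _].
have key u : u \in S -> alone fst S' (move_col x y c u) -> alone fst S u.
  move=> uS /aloneP al; apply/aloneP => w wS wu.
  apply: (can_in_inj (move_colK xS yS yal)) => //; apply: al => //.
  by rewrite in_imfset.
move=> _ _ /imfsetP[u /= uS ->] /imfsetP[v /= vS ->] uW vW /key ua /key va E.
congr move_col; apply: tS; rewrite ?ua ?va //.
have uy : u <> y by move=> uy; move: uW; rewrite uy yW.
have vy : v <> y by move=> vy; move: vW; rewrite vy yW.
move: E; rewrite /= (introF eqP uy) (introF eqP vy).
rewrite /c; case: (aloneP snd S y) => al /=; last by rewrite !subn0.
have uy2 : u.2 <> y.2 by move/(al _ uS).
have vy2 : v.2 <> y.2 by move/(al _ vS).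
(* Closing the gap at column [y.2] is the map [unbump], injective away from [y.2]. *)
by apply: (can_in_inj (@unbumpK y.2)); rewrite inE; apply/eqP.
Qed.

(** A single-one row is represented by its one. The list depends only on [S], so a pair can be
    recalled from its index. *)
Definition twins (S : {fset point}) : seq (point * point) :=
  [seq pq <- [seq (p, q) | p <- S, q <- S] |
    [&& pq.1 != pq.2, alone fst S pq.1, alone fst S pq.2 & pq.1.2 == pq.2.2]].

Lemma twinsP S p q :
  reflect [/\ p \in S /\ q \in S, p <> q, alone fst S p, alone fst S q & p.2 = q.2]
          ((p, q) \in twins S).
Proof.
rewrite mem_filter /=; apply: (iffP andP).
  move=> [/and4P[/eqP pq pa qa /eqP E] /allpairsP[[u v] /= [uS vS [Eu Ev]]]].
  by rewrite Eu Ev in pq pa qa E *.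
move=> [[pS qS] /eqP pq pa qa ->]; rewrite pq pa qa eqxx; split=> //.
by apply/allpairsP; exists (p, q).
Qed.

Lemma twins_uniq S : uniq (twins S).
Proof. by apply/filter_uniq/allpairs_uniq => // -[? ?] [? ?]. Qed.

(** One point of every twin pair lies in an exempt row, which determines it. The partner is
    determined by its own row if that is exempt, and otherwise by the common column. *)
Lemma size_twins W S : twinless W S ->
  size (twins S) <= size W * ((size W).+1 * 2).
Proof.
move=> tS.
(* The flag is [false] when the leading row is that of the first point; [None] marks a partner
   outside [W]. *)
pose f (pq : point * point) := if pq.1.1 \in W
  then (pq.1.1, (if pq.2.1 \in W then Some pq.2.1 else None, false))
  else (pq.2.1, (None, true)).
have -> : size W * ((size W).+1 * 2) = size [seq (w, c) | w <- W,
    c <- [seq (o, b) | o <- None :: map Some W, b <- [:: true; false]]].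
  by rewrite !size_allpairs /= size_map.
rewrite -(size_map f); apply: uniq_leq_size.
  rewrite map_inj_in_uniq ?twins_uniq // => -[p q] [p' q'].
  move=> /twinsP[[pS qS] _ /aloneP pa /aloneP qa pq].
  move=> /twinsP[[pS' qS'] _ /aloneP pa' /aloneP qa' pq'].
  rewrite /f /=; case: (boolP (p.1 \in W)) => pW; case: (boolP (p'.1 \in W)) => pW' //.
    case=> /(pa' p pS) E H; rewrite E in pq *; congr (_, _).
    have E2 : q.2 = q'.2 by rewrite -pq.
    case: ifPn H => qW; case: ifPn => qW' // H.
      by case: H => H; exact: qa'.
    by apply: tS => //; exact/aloneP.
  case=> /(qa' q qS) E; rewrite E in pq *; congr (_, _).
  by apply: tS; rewrite ?pq //; exact/aloneP.
move=> _ /mapP[[p q] /twinsP[[pS qS] pq pa qa E] ->].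
rewrite /f; case: ifPn => pW.
  apply: (allpairs_f pair) => //; apply: (allpairs_f pair); last by rewrite !inE orbT.
  by rewrite inE; case: ifP => qW //; rewrite map_f ?orbT.
have qW : q.1 \in W.
  by apply/negPn/negP => qW; apply: pq; exact: tS.
by apply: (allpairs_f pair) => //; apply: (allpairs_f pair); rewrite inE.
Qed.

(** * The encoding and its inverse *)

(** The three bits tell whether each row was really split and whether a column was deleted. Splits
    preserve columns, so [y1.2] is the old column of [y]. *)
Definition encode (S : {fset point}) (x y : point) :=
  let bx := ~~ alone fst S x in
  let S1 := [fset split_row x bx u | u in S] in
  let y1 := split_row x bx y in
  let b_y := ~~ alone fst S1 y1 in
  let S2 := [fset split_row y1 b_y u | u in S1] in
  let x2 := split_row y1 b_y x in
  let c := alone snd S2 y1 in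
  let move := move_col x2 y1 c in
  let S3 := [fset move u | u in S2] in
  (S3, (index (move x2, move y1) (twins S3), (bx, b_y, c), y1.2)).

(** The surgeries are undone in reverse order. The default of [nth] is never reached on the codes
    covered by [encodeP]. *)
Definition decode (code : {fset point} * (nat * (bool * bool * bool) * nat)) :=
  let: (S3, (i, (bx, b_y, c), v)) := code in
  let: (p, q) := nth ((0, 0), (0, 0)) (twins S3) i in
  let unmove := unmove_col q c v in
  let y1 := unmove q in
  let x := unsplit_row y1 b_y (unmove p) in
  let S2 := [fset unmove u | u in S3] in
  let S1 := [fset unsplit_row y1 b_y u | u in S2] in
  ([fset unsplit_row x bx u | u in S1], (x, unsplit_row x bx y1)).

Lemma encodeP n S x y : incidence n S -> twinless [::] S ->
  x \in S -> y \in S -> x <> y ->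
  [/\ incidence n (encode S x y).1, (encode S x y).2.1.1 < 40,
      (encode S x y).2.2 < n & decode (encode S x y) = (S, (x, y))].
Proof.
move=> iS tS xS yS xy; rewrite /encode /=.
set bx := ~~ alone fst S x; set S1 := [fset split_row x bx u | u in S].
set y1 := split_row x bx y.
have iS1 : incidence n S1 by exact: split_row_incidence.
have tS1 : twinless _ S1 := @split_row_twinless _ _ x bx tS.
have xa1 : alone fst S1 x by exact: split_row_alone.
have xS1 : x \in S1 by rewrite -(split_row_id x bx) in_imfset.
have yS1 : y1 \in S1 by rewrite in_imfset.
have xy1 : x <> y1.
  by rewrite -{1}(split_row_id x bx) => /(can_inj (split_rowK x bx)).
set b_y := ~~ alone fst S1 y1; set S2 := [fset split_row y1 b_y u | u in S1].
set x2 := split_row y1 b_y x.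
have iS2 : incidence n S2 by exact: split_row_incidence.
have tS2 : twinless _ S2 := @split_row_twinless _ _ y1 b_y tS1.
have xa2 : alone fst S2 x2 by exact: split_row_alone_pres.
have ya2 : alone fst S2 y1 by exact: split_row_alone.
have xS2 : x2 \in S2 by rewrite in_imfset.
have yS2 : y1 \in S2 by rewrite -{1}(split_row_id y1 b_y) in_imfset.
have xy2 : x2 <> y1.
  by rewrite -{1}(split_row_id y1 b_y) => /(can_inj (split_rowK y1 b_y)).
set c := alone snd S2 y1; set S3 := [fset move_col x2 y1 c u | u in S2].
have iS3 : incidence n S3 by exact: move_col_incidence.
(* The second split put the row of [y1] at the head of the exempt list, as the move requires. *)
have tS3 : twinless _ S3 := move_col_twinless xS2 yS2 xy2 ya2 (mem_head _ _) tS2.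
have moveK := move_colK xS2 yS2 ya2; rewrite -/c in moveK.
have tw : (move_col x2 y1 c x2, move_col x2 y1 c y1) \in twins S3.
  apply/twinsP; split; first by rewrite !in_imfset.
  - by move/(can_in_inj moveK)=> H; apply: xy2; exact: H.
  - exact: move_col_alone.
  - exact: move_col_alone.
  - exact: move_col_same.
split=> //.
(* Each split adds two exempt rows, so the list has length 4 and there are at most 4 * 5 * 2 = 40
   twin pairs. *)
- by rewrite (leq_trans _ (size_twins tS3)) // index_mem.
- by have [cS _ jS] := iS2; exact: initial_lt cS jS yS2.
- rewrite nth_index // !moveK // (imfset_can_in moveK) !split_rowK.
  rewrite (imfset_can_in (in1W (split_rowK y1 b_y))).
  by rewrite (imfset_can_in (in1W (split_rowK x bx))).
Qed.

(** * Counting codes *)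

Lemma size_allpairs_const (T1 T2 T3 : Type) (f : T1 -> T2 -> T3) (s : seq T1)
    (t : T1 -> seq T2) m : all (fun x => size (t x) == m) s ->
  size [seq f x y | x <- s, y <- t x] = size s * m.
Proof.
elim: s => //= x s IHs /andP[/eqP tx /IHs]; rewrite size_cat size_map tx mulSn.
by move=> ->.
Qed.

(** [encode] is injective on sets in [D] with an ordered pair of distinct points. Beside its set in
    [X], a code has 40 indices, 8 bit patterns and [n] columns, and 40 * 8 = 320. *)
Lemma size_twinless_incidence n (D X : seq {fset point}) : uniq D ->
  (forall S, S \in D -> incidence n S /\ twinless [::] S) ->
  (forall S, incidence n S -> S \in X) ->
  size D * (n * n.-1) <= size X * (320 * n).
Proof.
move=> uD hD hX.
(* Drawing [y] from [rem x] makes it distinct from [x] and leaves [n.-1] choices. *)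
pose dom := [seq (A, xy) | A : {fset point} <- D,
  xy : point * point <- [seq (x, y) | x <- enum_fset A, y <- rem x (enum_fset A)]].
pose cod := [seq (A, c) | A <- X, c <- [seq (ib, v) | ib <- [seq (i, b) |
  i <- iota 0 40, b <- enum {: bool * bool * bool}], v <- iota 0 n]].
have -> : size X * (320 * n) = size cod.
  by rewrite !size_allpairs -cardE !card_prod card_bool !size_iota.
have <- : size dom = size D * (n * n.-1).
  apply: size_allpairs_const; apply/allP => S /hD[[cS _ _] _].
  rewrite (@size_allpairs_const _ _ _ _ _ _ n.-1) ?cS //.
  by apply/allP => x xS; rewrite size_rem // cS.
have domP t : t \in dom -> [/\ t.1 \in D, t.2.1 \in t.1, t.2.2 \in t.1 & t.2.1 <> t.2.2].
  move=> /allpairsPdep[S [_ [SD /allpairsPdep[x [y [xS yS ->]]] ->]]] /=.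
  move: yS; rewrite mem_rem_uniq ?fset_uniq // inE => /andP[/eqP yx yS].
  by split=> //; apply: nesym.
pose enc t := encode t.1 t.2.1 t.2.2.
have encK : {in dom, cancel enc decode}.
  move=> [S [x y]] /domP[/= /hD[iS tS] xS yS xy].
  by case: (encodeP iS tS xS yS xy).
rewrite -(size_map enc); apply: uniq_leq_size.
  rewrite (map_inj_in_uniq (can_in_inj encK)); apply: allpairs_uniq_dep => //.
    move=> S SD; apply: allpairs_uniq_dep; first exact: fset_uniq.
      by move=> x _; rewrite rem_uniq.
    by move=> [a b] [a' b'] _ _ /= [-> ->].
  by move=> [a b] [a' b'] _ _ /= [-> ->].
move=> _ /mapP[[S [x y]] /domP[/= /hD[iS tS] xS yS xy] ->]; rewrite /enc.
have [iE lt40 ltn _] := encodeP iS tS xS yS xy.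
case: (encode S x y) iE lt40 ltn => B [[i b] v] /= iB i40 vn.
apply: (allpairs_f pair); first exact: hX.
apply: (allpairs_f pair); last by rewrite mem_iota.
by apply: (allpairs_f pair); [rewrite mem_iota|rewrite mem_enum].
Qed.

(** * Correspondence between matrices and point sets *)

Definition positions k l (A : 'M[bool]_(k, l)) : {fset point} :=
  [fset (nat_of_ord p.1, nat_of_ord p.2) | p in [set p : 'I_k * 'I_l | A p.1 p.2]%SET].

Lemma positionsP k l (A : 'M[bool]_(k, l)) u :
  reflect (exists i j, A i j /\ u = (nat_of_ord i, nat_of_ord j)) (u \in positions A).
Proof.
apply: (iffP (imfsetP _ _ _ _)) => /= [[[i j]]|[i [j [Aij ->]]]].
  by rewrite inE => Aij ->; exists i, j.
by exists (i, j); rewrite ?inE.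
Qed.

Lemma mem_positions k l (A : 'M[bool]_(k, l)) (i : 'I_k) (j : 'I_l) :
  ((nat_of_ord i, nat_of_ord j) \in positions A) = A i j.
Proof.
apply/positionsP/idP => [[i' [j' [Aij [/val_inj-> /val_inj->]]]] //|Aij].
by exists i, j.
Qed.

Lemma card_positions k l (A : 'M[bool]_(k, l)) : #|` positions A| = ones A.
Proof.
rewrite card_imfset /= -?cardE //.
by move=> [i j] [i' j'] [/val_inj-> /val_inj->].
Qed.

Lemma nonzero_rowP k l (A : 'M[bool]_(k, l)) :
  no_zero_row A <-> forall i, exists j, A i j.
Proof.
split=> nz i => [|/rowP r0]; last first.
  by have [j Aij] := nz i; have := r0 j; rewrite !mxE Aij.
apply: contrapT => /forallNP h; apply: (nz i).
by apply/rowP => j; rewrite !mxE; apply/negbTE/negP/h.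
Qed.

Lemma nonzero_colP k l (A : 'M[bool]_(k, l)) :
  no_zero_col A <-> forall j, exists i, A i j.
Proof.
split=> nz j => [|/colP r0]; last first.
  by have [i Aij] := nz j; have := r0 i; rewrite !mxE Aij.
apply: contrapT => /forallNP h; apply: (nz j).
by apply/colP => i; rewrite !mxE; apply/negbTE/negP/h.
Qed.

Lemma set1111_incidence n (A : zo_matrix) :
  set1111 n A -> incidence n (positions (tagged A)).
Proof.
case: A => -[k l] /= A [/= <- /nonzero_rowP nr /nonzero_colP nc].
split; first exact: card_positions.
- move=> u a /positionsP[i [j [_ ->]]] /= lt_ai.
  have [j' Aj'] := nr (Ordinal (ltn_trans lt_ai (ltn_ord i))).
  by exists (a, nat_of_ord j') => //; apply/positionsP; do 2!eexists; split; first exact: Aj'.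
- move=> u a /positionsP[i [j [_ ->]]] /= lt_aj.
  have [i' Ai'] := nc (Ordinal (ltn_trans lt_aj (ltn_ord j))).
  by exists (nat_of_ord i', a) => //; apply/positionsP; do 2!eexists; split; first exact: Ai'.
Qed.

(** Two rows whose single ones lie in the same column are equal. *)
Lemma set1011_twinless n (A : zo_matrix) :
  set1011 n A -> twinless [::] (positions (tagged A)).
Proof.
case: A => -[k l] /= A [_ /= neq] u v /positionsP[i [j [Aij Eu]]] /positionsP[i' [j' [Aij' Ev]]].
move=> _ _ /aloneP ua /aloneP va; rewrite Eu Ev /= => jj; congr (_, _); last exact: jj.
apply: contrapT => ii; apply: (neq i i') => [ii'|]; first by apply: ii; rewrite ii'.
apply/rowP => m; rewrite !mxE; apply/idP/idP => Am.
  have := ua (nat_of_ord i, nat_of_ord m); rewrite mem_positions Eu => /(_ Am erefl)[mj].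
  by rewrite (val_inj (etrans mj jj : val m = val j')).
have := va (nat_of_ord i', nat_of_ord m); rewrite mem_positions Ev => /(_ Am erefl)[mj].
by rewrite (val_inj (etrans mj (esym jj) : val m = val j)).
Qed.

(** Positions forget the dimensions, but every row and column holds a one, so each matrix is at
    least as large as the other. *)
Lemma positions_inj n (A B : zo_matrix) : set1111 n A -> set1111 n B ->
  positions (tagged A) = positions (tagged B) -> A = B.
Proof.
have le k l (M : 'M[bool]_(k, l)) k' l' (N : 'M[bool]_(k', l')) :
    no_zero_row M -> no_zero_col M -> positions M = positions N -> k <= k' /\ l <= l'.
  move=> /nonzero_rowP nr /nonzero_colP nc E; split; rewrite leqNgt; apply/negP => lt.
    have [j Mj] := nr (Ordinal lt); have := mem_positions M (Ordinal lt) j.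
    by rewrite Mj E => /positionsP[i [? [_ [ki _]]]]; have := ltn_ord i; rewrite -ki ltnn.
  have [i Mi] := nc (Ordinal lt); have := mem_positions M i (Ordinal lt).
  by rewrite Mi E => /positionsP[? [j [_ [_ lj]]]]; have := ltn_ord j; rewrite -lj ltnn.
case: A B => -[k l] A [[k' l'] B] [/= _ rA cA] [/= _ rB cB] E.
have [kk ll] := le _ _ _ _ _ _ rA cA E; have [kk' ll'] := le _ _ _ _ _ _ rB cB (esym E).
have ek : k = k' by apply/eqP; rewrite eqn_leq kk kk'.
have el : l = l' by apply/eqP; rewrite eqn_leq ll ll'.
subst k' l'; congr existT; apply/matrixP => i j.
by rewrite -!mem_positions E.
Qed.

(** The dimensions are the least that hold all points, 0 by 0 for the empty set. *)
Definition of_positions (S : {fset point}) : zo_matrix :=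
  existT (fun d : nat * nat => 'M[bool]_(d.1, d.2))
    (\max_(u <- S) u.1.+1, \max_(u <- S) u.2.+1)
    (\matrix_(i, j) ((nat_of_ord i, nat_of_ord j) \in S))%R.

Lemma of_positionsK S : positions (tagged (of_positions S)) = S.
Proof.
apply/fsetP => -[a b]; apply/positionsP/idP => [[i [j [+ ->]]]|abS]; first by rewrite mxE.
have lt1 : a < \max_(u <- S) u.1.+1.
  by apply: (@leq_bigmax_seq _ _ _ (fun u : point => u.1.+1) _ abS).
have lt2 : b < \max_(u <- S) u.2.+1.
  by apply: (@leq_bigmax_seq _ _ _ (fun u : point => u.2.+1) _ abS).
by exists (Ordinal lt1), (Ordinal lt2); rewrite mxE.
Qed.

Lemma initial_max h S a : initial h S -> a < \max_(u <- S) (h u).+1 ->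
  exists2 u, u \in S & h u = a.
Proof.
move=> hS lt_a.
have [u uS le_au] : exists2 u, u \in S & a <= h u.
  apply: contrapT => no; move: lt_a; rewrite ltnNge => /negP; apply.
  apply/bigmax_leqP_seq => u uS _; rewrite ltnNge; apply/negP => le_au.
  by apply: no; exists u.
by move: le_au; rewrite leq_eqVlt => /orP[/eqP ->|/(hS _ _ uS)//]; exists u.
Qed.

Lemma of_positions_set1111 n S : incidence n S -> set1111 n (of_positions S).
Proof.
move=> [cS hS1 hS2]; split; first by rewrite -card_positions of_positionsK.
- apply/nonzero_rowP => i.
  have [[a b] abS /= ai] := initial_max hS1 (ltn_ord i).
  have := abS; rewrite -{1}(of_positionsK S) => /positionsP[i' [j [Aij [ai' _]]]].
  by exists j; rewrite -(val_inj (etrans (esym ai') ai : val i' = val i)).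
- apply/nonzero_colP => j.
  have [[a b] abS /= bj] := initial_max hS2 (ltn_ord j).
  have := abS; rewrite -{1}(of_positionsK S) => /positionsP[i [j' [Aij [_ bj']]]].
  by exists i; rewrite -(val_inj (etrans (esym bj') bj : val j' = val j)).
Qed.

(** * The inequality between the two counts and its limit *)

Lemma F1011_le n : F1011 n * (n * n.-1) <= F1111 n * (320 * n).
Proof.
have in11 A : (A \in fset_set (set1111 n)) -> set1111 n A.
  by rewrite in_fset_set ?inE //; exact: finite_set1111.
have in10 A : (A \in fset_set (set1011 n)) -> set1011 n A.
  by rewrite in_fset_set ?inE //; exact: finite_set1011.
pose pos (A : zo_matrix) := positions (tagged A).
rewrite /F1011 /F1111 -(size_map pos (fset_set (set1011 n))).
rewrite -(size_map pos (fset_set (set1111 n))).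
apply: size_twinless_incidence.
- rewrite map_inj_in_uniq ?fset_uniq // => A B /in10[nA _] /in10[nB _].
  exact: positions_inj nA nB.
- move=> S /mapP[A /in10 nA ->]; split; last exact: set1011_twinless nA.
  by have [nA' _] := nA; exact: set1111_incidence.
- move=> S iS; apply/mapP; exists (of_positions S); last by rewrite /pos of_positionsK.
  rewrite in_fset_set; last exact: finite_set1111.
  by rewrite inE; exact: of_positions_set1111.
Qed.

Local Open Scope classical_set_scope.
Local Open Scope ring_scope.

Theorem theorem5 (R : realType) :
  (fun n : nat => (F1011 n)%:R : R) =o_\oo (fun n : nat => (F1111 n)%:R : R).
Proof.
apply/eqoP => e e0; near=> n.
(* This threshold amounts to 320 <= e (n - 1). *)
have n_ge : e^-1 * 320 + 1 <= n%:R by near: n; exact: nbhs_infty_ger.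
have n_gt1 : (1 < n)%N by near: n; exact: nbhs_infty_gt.
have n_gt0 : (0 < n)%N := ltnW n_gt1.
have predn_gt0 : (0 < n.-1)%N by rewrite -ltnS prednK.
(* Both sides are brought to the form of a multiple of [n], which is then cancelled. *)
have := F1011_le n; rewrite mulnCA [X in (_ <= X)%N]mulnA [X in (_ <= X)%N]mulnC.
rewrite leq_pmul2l // => le.
rewrite !normr_nat -(ler_pM2r (_ : 0 < n.-1%:R :> R)) ?ltr0n // -natrM.
apply: (@le_trans _ _ ((F1111 n)%:R * 320)); first by rewrite -natrM ler_nat.
rewrite mulrAC mulrC ler_wpM2r // -ler_pdivrMl //.
by rewrite -(lerD2r 1) natr1 prednK.
Unshelve. all: by end_near. Qed.
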